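(* Let $\hat X\in E$, and for parameters $\Delta t>0$, $\rho>0$, $c\ge0$ put $$c_1:=\rho(\Delta t)^2(1+c(\Delta t)^2),\quad c_2:=\rho(\Delta t)^3(1+c(\Delta t)^2),\quad c_3:=c\rho(\Delta t)^3,\quad T:=I-c_2\mathbb B\mathbb B^*.$$ (i) Suppose that $\nabla\mathbb V$ is uniformly continuous and that there exist $\underline\psi>0$ and a closed subspace $E_0\subseteq\operatorname{ran}(\mathbb B)$ such that $$\langle V,\Psi(X)V\rangle\ge\underline\psi\,\|(I-P_{E_0})V\|^2\quad\text{for all }X,V\in E,$$ where $P_{E_0}$ is the orthogonal projection onto $E_0$. Let $\Delta t>0$, $c\ge0$ and let $\rho$ satisfy $$0<\rho<\frac{1}{(\Delta t)^3(1+c(\Delta t)^2)\|\mathbb B\mathbb B^*\|}.$$ Let $X,V\in C^1([0,\infty);E)$ be solutions to $$\tfrac{d}{dt}X_t=V_t,\qquad\tfrac{d}{dt}V_t=-c_1\mathbb B\mathbb B^*V_t-(I-c_2\mathbb B\mathbb B^* )\bigl(\Psi(X_t)V_t+\nabla\mathbb V(X_t)\bigr)-c_3\mathbb B\mathbb B^*(X_t-\hat X).$$ Then $V_t\to0$ and $\nabla\mathbb V(X_t)+c_3T^{-1}\mathbb B\mathbb B^*(X_t-\hat X)\to0$ in $E$ as $t\to\infty$. (ii) Let $\mathbb B$ be surjective and $\nabla\mathbb V$ be Lipschitz. Then there exists a constant $K>0$, depending on $\mathbb B$ and a Lipschitz constant of $\nabla\mathbb V$, such that if $\Delta t,\rho,c$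 satisfy $$0<\Delta t<\frac{1}{\sqrt{K\|\mathbb B\mathbb B^*\|}},\qquad c>\frac{K\|\mathbb B\mathbb B^*\|}{1-(\Delta t)^2K\|\mathbb B\mathbb B^*\|},\qquad\frac{K}{c(\Delta t)^3}<\rho<\frac{1}{(\Delta t)^3(1+c(\Delta t)^2)\|\mathbb B\mathbb B^*\|},$$ then any solution $X,V\in C^1([0,\infty);E)$ to $$\tfrac{d}{dt}X_t=V_t,\qquad\tfrac{d}{dt}V_t=-c_1\mathbb B\mathbb B^*V_t-(I-c_2\mathbb B\mathbb B^* )\bigl(\Psi(X_t)V_t+\nabla\mathbb V(X_t)-\nabla\mathbb V(\hat X)\bigr)-c_3\mathbb B\mathbb B^*(X_t-\hat X)$$ satisfies $V_t\to0$ and $X_t\to\hat X$ in $E$ as $t\to\infty$.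
   Context: Standing assumptions. $E,U$ are real Hilbert spaces with norms $\|\cdot\|$ and inner products $\langle\cdot,\cdot\rangle$; gradients are Riesz gradients. $\mathbb V\in C^1(E;\mathbb R)$ is bounded from below by $\underline{\mathcal V}\in\mathbb R$ and there is $C>0$ with $\|\nabla\mathbb V(X)\|^2\le C(1+\mathbb V(X)-\underline{\mathcal V})$ for all $X\in E$. $\Psi:E\to\mathscr L(E)$ is bounded (i.e. $\sup_X\|\Psi(X)\|<\infty$) and $\Psi(X)$ is self-adjoint and positive semidefinite for every $X\in E$. $\mathbb B\in\mathscr L(U;E)$ has closed range; $\mathbb B^*$ is its adjoint. *)

(* Defs.v *)
From HB Require Import structures.
From mathcomp Require Import all_boot all_order all_algebra.
From mathcomp Require Import all_classical all_reals all_analysis.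

Set Implicit Arguments.
Unset Strict Implicit.
Unset Printing Implicit Defensive.

Import Order.TTheory GRing.Theory Num.Theory.
Import numFieldNormedType.Exports.

Local Open Scope classical_set_scope.
Local Open Scope ring_scope.

HB.mixin Record NormedModule_isHilbert (R : realType) H & NormedModule R H := {
  hdot : {dot H for (@idfun R)} ;
  normr_hdot : forall x : H, `|x| ^+ 2 = hdot x x
}.

#[short(type="hilbertType")]
HB.structure Definition Hilbert (R : realType) :=
  {H of NormedModule_isHilbert R H & CompleteNormedModule R H}.

Notation "''[' u , v ]" := (hdot u v) : ring_scope.

Section Operators.
Context {R : realType}.

(* A real supremum, so meaningful for bounded operators only (sup is 0 on
   unbounded sets); it is 0 on the trivial space. *)
Definition opnorm {V W : normedModType R} (f : V -> W) : R :=
  sup [set `|f x| | x in [set x : V | `|x| <= 1]].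

(* In the next three definitions the defining property has exactly one
   solution under the intended hypotheses (A, resp. 'd f x, bounded linear;
   S a closed subspace), by the Riesz and projection theorems. *)
Definition adjoint {U E : hilbertType R} (A : U -> E) (x : E) : U :=
  get [set w | forall u, '[A u, x] = '[u, w]].

Definition gradient {E : hilbertType R} (f : E -> R) (x : E) : E :=
  get [set g | forall h, 'd f x h = '[g, h]].

Definition orthoproj {E : hilbertType R} (S : set E) (x : E) : E :=
  get [set p | S p /\ forall y, S y -> '[x - p, y] = 0].

Definition self_adjoint {E : hilbertType R} (A : E -> E) : Prop :=
  forall u v, '[A u, v] = '[u, A v].

Definition positive_semidefinite {E : hilbertType R} (A : E -> E) : Prop :=
  forall v, 0 <= '[v, A v].

Definition closed_subspace {E : hilbertType R} (S : set E) : Prop :=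
  GRing.submod_closed [pred x | x \in S] /\ closed S.

Definition C1 {E : normedModType R} (f : E -> R) : Prop :=
  (forall x, differentiable f x) /\
  forall x, opnorm (fun h => 'd f y h - 'd f x h) @[y --> x] --> 0.

(* Derivative along [0, +oo[: two-sided for t > 0, one-sided at t = 0.  Values
   of f at negative times are irrelevant. *)
Definition is_derive_ge0 {E : normedModType R} (f : R -> E) (t : R) (df : E) :=
  (s - t)^-1 *: (f s - f t) @[s --> within `[0, +oo[ t^'] --> df.

Definition C1_ge0 {E : normedModType R} (f : R -> E) : Prop :=
  exists2 df : R -> E, {within `[0, +oo[, continuous df} &
    forall t, 0 <= t -> is_derive_ge0 f t (df t).

End Operators.

Section Dynamics.
Context {R : realType}.

Definition potential {E : hilbertType R} (pot : E -> R) (potlow : R) : Prop :=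
  [/\ C1 pot, forall x, potlow <= pot x &
      exists2 C, 0 < C &
        forall x, `|gradient pot x| ^+ 2 <= C * (1 + pot x - potlow)].

Definition damping {E : hilbertType R} (Psi : E -> {linear E -> E}) : Prop :=
  [/\ forall x, continuous (Psi x),
      has_ubound (range (fun x => opnorm (Psi x))),
      forall x, self_adjoint (Psi x) &
      forall x, positive_semidefinite (Psi x)].

Definition c1 (rho dt c : R) : R := rho * dt ^+ 2 * (1 + c * dt ^+ 2).
Definition c2 (rho dt c : R) : R := rho * dt ^+ 3 * (1 + c * dt ^+ 2).
Definition c3 (rho dt c : R) : R := c * rho * dt ^+ 3.

Context {E U : hilbertType R}.

Definition BBadj (B : U -> E) : E -> E := B \o adjoint B.

Definition opT (B : U -> E) (rho dt c : R) (x : E) : E :=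
  x - c2 rho dt c *: BBadj B x.

(* The vector field G is the gradient of the potential in the first system and
   the gradient minus its value at Xhat in the second one. *)
Definition solution (B : U -> E) (Psi : E -> {linear E -> E}) (G : E -> E)
    (Xhat : E) (rho dt c : R) (X V : R -> E) : Prop :=
  [/\ C1_ge0 X, C1_ge0 V,
      forall t, 0 <= t -> is_derive_ge0 X t (V t) &
      forall t, 0 <= t -> is_derive_ge0 V t
        (- (c1 rho dt c *: BBadj B (V t))
         - opT B rho dt c (Psi (X t) (V t) + G (X t))
         - c3 rho dt c *: BBadj B (X t - Xhat))].

End Dynamics.

(* Main.v *)
(* Let S = B B^* and T = I - c2 S, a positive invertible operator commuting with
   S.  The energy
     1/2 <T^-1 V, V> + pot(X) + c3/2 <T^-1 S (X - Xhat), X - Xhat>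
   decays at rate c1 <T^-1 S V, V> + <V, Psi(X) V>, and T^-1 S >= S.  Since
   the range of B is closed, B^* is bounded below on it, so S and Psi together
   make the rate at least eta |V|^2.  The energy being bounded below, all terms
   of the equation stay bounded, V is Lipschitz in time and tends to 0.  Then
   V' = o(1) - T W with W = grad pot(X) + c3 T^-1 S (X - Xhat) uniformly
   continuous in time, which forces W to tend to 0.  In the surjective case
   S >= b^-2, and c3 > K = L b^2 + 1 makes the quadratic term dominate the
   Lipschitz gradient, so that W -> 0 entails X -> Xhat. *)
Require Import Defs.
From HB Require Import structures.
From mathcomp Require Import all_boot all_order all_algebra.
From mathcomp Require Import all_classical all_reals all_analysis.
From mathcomp Require Import ring lra.

Set Implicit Arguments.
Unset Strict Implicit.
Unset Printing Implicit Defensive.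

Import Order.TTheory GRing.Theory Num.Theory.
Import numFieldNormedType.Exports.

Local Open Scope classical_set_scope.
Local Open Scope ring_scope.

(** * Inner product calculus *)

Section InnerProduct.
Context {R : realType} {E : hilbertType R}.
Implicit Types (u v w x y : E) (a : R).

Lemma hdotC u v : '[u, v] = '[v, u].
Proof. by rewrite [LHS]hermC expr0 mul1r. Qed.

Lemma hdotDl u v w : '[u + v, w] = '[u, w] + '[v, w].
Proof. exact: linearDl. Qed.

Lemma hdotDr u v w : '[u, v + w] = '[u, v] + '[u, w].
Proof. exact: linearDr. Qed.

Lemma hdotNl u v : '[- u, v] = - '[u, v].
Proof. exact: linearNl. Qed.

Lemma hdotNr u v : '[u, - v] = - '[u, v].
Proof. exact: linearNr. Qed.

Lemma hdotZl a u v : '[a *: u, v] = a * '[u, v].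
Proof. exact: linearZl_LR. Qed.

Lemma hdotZr a u v : '[u, a *: v] = a * '[u, v].
Proof. by rewrite hdotC hdotZl hdotC. Qed.

Lemma hdot0l u : '[0, u] = 0.
Proof. exact: linear0l. Qed.

Definition hdotE := (hdotDl, hdotDr, hdotNl, hdotNr, hdotZl, hdotZr).

Lemma sqnormB u v : `|u - v| ^+ 2 = `|u| ^+ 2 - 2 * '[u, v] + `|v| ^+ 2.
Proof. by rewrite !normr_hdot !hdotE (hdotC v u); ring. Qed.

Lemma sqnormD u v : `|u + v| ^+ 2 = `|u| ^+ 2 + 2 * '[u, v] + `|v| ^+ 2.
Proof. by rewrite !normr_hdot !hdotE (hdotC v u); ring. Qed.

(** Cauchy-Schwarz: expand the square of [|v| u - |u| v] and cancel the positive factor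
    [|u| |v|]. *)
Lemma hdot_le u v : '[u, v] <= `|u| * `|v|.
Proof.
have [->|v0] := eqVneq v 0; first by rewrite hdotC hdot0l normr0 mulr0.
have nv : 0 < `|v| by rewrite normr_gt0.
have := sqr_ge0 `| (`|v| *: u - `|u| *: v) |.
rewrite sqnormB !normrZ !hdotE !normr_id => h.
have [->|u0] := eqVneq u 0; first by rewrite hdot0l normr0 mul0r.
have nu : 0 < `|u| by rewrite normr_gt0.
rewrite -(ler_pM2l nv) -(ler_pM2l nu); lra.
Qed.

Lemma normr_hdot_le u v : `|'[u, v]| <= `|u| * `|v|.
Proof. by rewrite ler_norml hdot_le lerNl -hdotNl -(normrN u) hdot_le. Qed.

Lemma hdot_eqP u v : (forall w, '[u, w] = '[v, w]) -> u = v.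
Proof.
move=> uv; apply/eqP; rewrite -subr_eq0 -normr_eq0 -sqrf_eq0 normr_hdot.
by rewrite hdotDl hdotNl uv subrr.
Qed.

(** Serves to bound a vector by testing it against itself, without a case split at zero. *)
Lemma ler_norm_of_sqr (k : R) u : 0 <= k -> `|u| ^+ 2 <= k * `|u| -> `|u| <= k.
Proof.
move=> k0; have [->|u0] := eqVneq u 0; first by rewrite normr0.
by rewrite expr2 ler_pM2r // normr_gt0.
Qed.

(** Polarization reduces joint continuity of the inner product to continuity of the norm. *)
Lemma cvg_hdot (T : Type) (F : set_system T) {FF : Filter F} (f g : T -> E) x y :
  f @ F --> x -> g @ F --> y -> '[f t, g t] @[t --> F] --> '[x, y].
Proof.
move=> fx gy.
have -> : (fun t => '[f t, g t]) =
    (fun t => 2^-1 * (`|f t + g t| ^+ 2 - `|f t| ^+ 2 - `|g t| ^+ 2)).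
  by apply/funext => t; rewrite sqnormD; field.
have -> : '[x, y] = 2^-1 * (`|x + y| ^+ 2 - `|x| ^+ 2 - `|y| ^+ 2).
  by rewrite sqnormD; field.
have sqr (h : T -> E) z : h @ F --> z -> `|h t| ^+ 2 @[t --> F] --> `|z| ^+ 2.
  by move=> hz; rewrite expr2; apply: cvgM; apply: cvg_norm.
by apply: cvgMr; apply: cvgB; [apply: cvgB|]; apply: sqr => //; exact: cvgD.
Qed.

End InnerProduct.

(** * Riesz representation and orthogonal projection *)

Section Riesz.
Context {R : realType} {E : hilbertType R}.

(* The representative minimises |y|^2 - 2 l(y) on S: minimising sequences are
   Cauchy by the parallelogram identity.  For S the whole space this is the
   Riesz theorem, for l the inner product with x the projection theorem. *)
Lemma riesz_subspace (S : set E) (l : E -> R) (C : R) :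
  S 0 -> (forall a x y, S x -> S y -> S (a *: x + y)) -> closed S ->
  (forall a x y, l (a *: x + y) = a * l x + l y) ->
  (forall x, l x <= C * `|x|) ->
  exists2 p, S p & forall y, S y -> '[p, y] = l y.
Proof.
move=> S0 SP Scl lP lC.
have l0 : l 0 = 0 by have := lP (- 1) 0 0; rewrite scaler0 addr0 mulN1r addNr.
have lZ a x : l (a *: x) = a * l x by rewrite -[a *: x]addr0 lP l0 addr0.
have lD x y : l (x + y) = l x + l y by rewrite -[x]scale1r lP mul1r scale1r.
have SZ a x : S x -> S (a *: x) by move=> Sx; rewrite -[_ *: _]addr0; exact: SP.
have SD x y : S x -> S y -> S (x + y).
  by move=> Sx Sy; rewrite -[x]scale1r; exact: SP.
pose J y := `|y| ^+ 2 - 2 * l y.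
have J_ge y : - C ^+ 2 <= J y.
  have := lC y; have := sqr_ge0 (`|y| - C); rewrite /J; nra.
pose m := inf [set J y | y in S].
have hasJ : has_inf [set J y | y in S].
  split; first by exists (J 0), 0.
  by exists (- C ^+ 2) => _ [y _ <-].
have m_le y : S y -> m <= J y.
  by move=> Sy; apply: (ge_inf hasJ.2); exists y.
have approx (n : nat) : exists y, S y /\ J y < m + n.+1%:R^-1.
  have [|_ [y Sy <-] h] := @inf_adherent _ [set J y | y in S] n.+1%:R^-1 _ hasJ.
    by rewrite invr_gt0.
  by exists y.
have [u uP] := choice approx.
(* The midpoint of [u n] and [u k] lies in [S], so [J] is at least [m] there. *)
have par n k : `|u n - u k| ^+ 2 <= 2 * (n.+1%:R^-1 + k.+1%:R^-1).
  have [[Sn Jn] [Sk Jk]] := (uP n, uP k).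
  have := m_le _ (SZ 2^-1 _ (SD _ _ Sn Sk)).
  move: Jn Jk; rewrite /J lZ lD normrZ exprMn sqnormB sqnormD ger0_norm //.
  have -> : 2^-1 ^+ 2 = 4^-1 :> R by field.
  move: (n.+1%:R^-1) (k.+1%:R^-1) => a b.
  lra.
have cu : cvg (u @ \oo).
  apply: cauchy_cvg; apply: cauchy_exP => e e0.
  have e20 : 0 < e ^+ 2 / 4 by rewrite divr_gt0 ?exprn_gt0.
  have [N _ HN] : \forall n \near \oo, n.+1%:R^-1 < e ^+ 2 / 4 :> R.
    by apply: (near_infty_natSinv_lt (PosNum e20)).
  exists (u N); exists N => // n /= Nn.
  rewrite -ball_normE /ball_ /=.
  rewrite -(@ltr_pXn2r _ 2) ?nnegrE ?(ltW e0) //.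
  apply: le_lt_trans (par N n) _.
  have := HN N (leqnn _); have := HN n Nn => /=.
  by move: (n.+1%:R^-1) (N.+1%:R^-1) => a b; lra.
pose p := lim (u @ \oo).
have Sp : S p.
  by apply: (closed_cvg S) cu => //; apply: nearW => n; case: (uP n).
have lc : l (u n) @[n --> \oo] --> l p.
  have lN x : l (- x) = - l x by rewrite -scaleN1r lZ mulN1r.
  have labs x : `|l x| <= `|C| * `|x|.
    have CC x' : C * `|x'| <= `|C| * `|x'| by rewrite ler_wpM2r // ler_norm.
    rewrite ler_norml (le_trans (lC _)) // andbT lerNl -lN -(normrN x).
    by rewrite (le_trans (lC _)).
  apply/cvgrPdist_lt => e e0; near=> n.
  rewrite -lN -lD; apply: le_lt_trans (labs _) _.
  have C1 : 0 < `|C| + 1 by rewrite ltr_wpDl.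
  apply: (@le_lt_trans _ _ ((`|C| + 1) * `|p - u n|)).
    by rewrite ler_wpM2r // lerDl.
  rewrite mulrC -ltr_pdivlMr //.
  by near: n; move/cvgrPdist_lt: cu; apply; rewrite divr_gt0.
have Jp : J p <= m.
  have Jc : J (u n) @[n --> \oo] --> J p.
    by apply: cvgB; [rewrite expr2; apply: cvgM; apply: cvg_norm|apply: cvgMr].
  have mc : m + n.+1%:R^-1 @[n --> \oo] --> m.
    by rewrite -[X in _ --> X]addr0; apply: cvgD; [exact: cvg_cst|exact: cvg_harmonic].
  apply: ler_cvg_to Jc mc _.
  by apply: nearW => n; apply: ltW; case: (uP n).
exists p => // y Sy; apply/eqP; rewrite -subr_eq0; apply/eqP.
(* First variation: compare [p] with [p - (a / N) y]. Minimality, multiplied by [N ^+ 2], becomes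
   [0 <= - a ^+ 2 * (N + 1)], hence [a = 0]. The [+ 1] in [N] covers [y = 0]. *)
set a := _ - _; set N := `|y| ^+ 2 + 1.
have N0 : 0 < N by rewrite ltr_wpDl // sqr_ge0.
have := le_trans Jp (m_le _ (SD _ _ Sp (SZ (- a / N) _ Sy))).
rewrite /J sqnormD lD lZ hdotZr normrZ exprMn real_normK ?num_real // => h.
have h1 : 0 <= (- a / N) ^+ 2 * `|y| ^+ 2 + 2 * (- a / N) * a.
  move: (- a / N) h => k h; rewrite /a; lra.
have h2 : 0 <= - a ^+ 2 * (N + 1).
  have : 0 <= ((- a / N) ^+ 2 * `|y| ^+ 2 + 2 * (- a / N) * a) * N ^+ 2.
    by rewrite mulr_ge0 // sqr_ge0.
  suff -> : ((- a / N) ^+ 2 * `|y| ^+ 2 + 2 * (- a / N) * a) * N ^+ 2 =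
    - a ^+ 2 * (N + 1) by [].
  have -> : `|y| ^+ 2 = N - 1 by rewrite /N addrK.
  by field; rewrite gt_eqF.
apply/eqP; rewrite -sqrf_eq0; apply/eqP; apply/le_anti.
by rewrite sqr_ge0 andbT; nra.
Unshelve. all: by end_near. Qed.

Lemma riesz (l : E -> R) (C : R) :
  (forall a x y, l (a *: x + y) = a * l x + l y) ->
  (forall x, l x <= C * `|x|) -> exists p, forall y, '[p, y] = l y.
Proof.
move=> lP lC; have [//|//|p _ h] := @riesz_subspace setT l C _ _ closedT lP lC.
by exists p => y; exact: h.
Qed.

End Riesz.

(** Adjoints and [BBadj B] are plain functions; rewriting with this equation opens the theory of
    linear maps to them. *)
Lemma linear_bundle (K : nzRingType) (V W : lmodType K) (f : V -> W) :
  linear f -> exists g : {linear V -> W}, f = g.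
Proof.
move=> lf.
pose g : {linear V -> W} := HB.pack f (GRing.isLinear.Build _ _ _ _ _ lf).
by exists g.
Qed.

(** * Bounded operators, adjoints, gradients and projections *)

Section BoundedOperators.
Context {R : realType}.

Lemma has_ubound_opnorm (V W : normedModType R) (f : {linear V -> W}) :
  continuous f -> has_ubound [set `|f x| | x in [set x : V | `|x| <= 1]].
Proof.
move=> /linear_lipschitz[k k0 fk]; exists k => _ [y /= y1 <-].
by apply: le_trans (fk y) _; rewrite -[leRHS]mulr1 ler_pM2l.
Qed.

Lemma opnorm_ge0 (V W : normedModType R) (f : {linear V -> W}) :
  continuous f -> 0 <= opnorm f.
Proof.
move=> fc; apply: (ub_le_sup (has_ubound_opnorm fc)).
by exists 0; rewrite /= ?linear0 ?normr0.
Qed.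

Lemma opnorm_le (V W : normedModType R) (f : {linear V -> W}) (x : V) :
  continuous f -> `|f x| <= opnorm f * `|x|.
Proof.
move=> fc; have [->|x0] := eqVneq x 0; first by rewrite linear0 !normr0 mulr0.
have nx : 0 < `|x| by rewrite normr_gt0.
rewrite -ler_pdivrMr // mulrC.
have -> : `|x|^-1 * `|f x| = `|f (`|x|^-1 *: x)|.
  by rewrite linearZ normrZ ger0_norm // invr_ge0.
apply: (ub_le_sup (has_ubound_opnorm fc)).
by exists (`|x|^-1 *: x) => //=; rewrite normrZ normfV normr_id mulVf // gt_eqF.
Qed.

Lemma bounded_continuous (V W : normedModType R) (f : {linear V -> W}) (k : R) :
  (forall x, `|f x| <= k * `|x|) -> continuous f.
Proof.
move=> fk; apply: bounded_linear_continuous; apply/linear_boundedP.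
exists k; split=> [|r kr x]; first exact: num_real.
by apply: le_trans (fk x) _; rewrite ler_wpM2r // ltW.
Qed.

(** Riesz applied to [u |-> '[A u, x]] shows that the set behind [get] is inhabited. *)
Lemma adjointP (U E : hilbertType R) (A : {linear U -> E}) : continuous A ->
  forall u x, '[A u, x] = '[u, adjoint A x].
Proof.
move=> /linear_lipschitz[k k0 Ak] + x.
apply: (@getPex _ [set w | forall u, '[A u, x] = '[u, w]]).
have [||p pP] := @riesz R U (fun u => '[A u, x]) (k * `|x|).
- by move=> a u v; rewrite linearP hdotDl hdotZl.
- move=> u; apply: le_trans (hdot_le _ _) _.
  by rewrite mulrAC ler_wpM2r.
by exists p => u; rewrite -pP hdotC.
Qed.

Lemma gradientP (E : hilbertType R) (f : E -> R) (x : E) :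
  differentiable f x -> forall h, 'd f x h = '[gradient f x, h].
Proof.
move=> df; apply: (@getPex _ [set g | forall h, 'd f x h = '[g, h]]).
have [k _ dk] := linear_lipschitz (diff_continuous df).
have [||p pP] := @riesz R E ('d f x) k.
- by move=> a u v; rewrite linearP.
- by move=> u; apply: le_trans (dk u); rewrite ler_norm.
by exists p => h; rewrite pP.
Qed.

Lemma closed_subspaceP (E : hilbertType R) (S : set E) : closed_subspace S ->
  [/\ S 0, forall a x y, S x -> S y -> S (a *: x + y) & closed S].
Proof.
move=> [[S0 SP] Scl]; split => //; first by move: S0; rewrite inE.
move=> a x y Sx Sy.
by apply/set_mem/(SP a x y); exact/mem_set.
Qed.

Lemma orthoprojP (E : hilbertType R) (S : set E) (x : E) : closed_subspace S ->
  S (orthoproj S x) /\ forall y, S y -> '[x - orthoproj S x, y] = 0.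
Proof.
move=> /closed_subspaceP[S0 SP Scl].
apply: (@getPex _ [set p | S p /\ forall y, S y -> '[x - p, y] = 0]).
have [||p Sp pP] := @riesz_subspace R E S (fun y => '[x, y]) `|x| S0 SP Scl.
- by move=> a u v; rewrite hdotDr hdotZr.
- by move=> u; exact: hdot_le.
by exists p; split => // y Sy; rewrite hdotDl hdotNl pP // subrr.
Qed.

Lemma closed_subspace_range (U E : hilbertType R) (A : {linear U -> E}) :
  closed (range A) -> closed_subspace (range A).
Proof.
move=> Acl; split => //; split.
  by apply/mem_set; exists 0; rewrite ?linear0.
move=> a x y /set_mem[u _ <-] /set_mem[v _ <-].
by apply/mem_set; exists (a *: u + v); rewrite ?linearP.
Qed.

Lemma adjoint_linear (U E : hilbertType R) (A : {linear U -> E}) :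
  continuous A -> linear (adjoint A).
Proof.
move=> Ac a x y; apply: hdot_eqP => w; rewrite hdotDl hdotZl.
by rewrite ![ '[adjoint _ _, w] ]hdotC -!adjointP // hdotDr hdotZr.
Qed.

(* The functionals '[z, -] with z in the range and |A^* z| <= 1 are pointwise
   bounded, so the uniform boundedness principle bounds them in norm. *)
Lemma adjoint_bounded_below (U E : hilbertType R) (A : {linear U -> E}) :
  continuous A -> closed (range A) ->
  exists2 b, 0 < b & forall y, range A y -> `|y| <= b * `|adjoint A y|.
Proof.
move=> Ac /closed_subspace_range Acl.
pose F : set (E -> R) :=
  [set f | exists z, [/\ range A z, `|adjoint A z| <= 1 & f = hdot z]].
have [||M HM] := (@Banach_Steinhauss R E R F _ _) 1.
- move=> _ [z [_ _ ->]]; split.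
    move=> r; exists (`|z| * r) => x xr.
    by apply: le_trans (normr_hdot_le _ _) _; rewrite ler_wpM2l.
  by move=> a u v; rewrite hdotDr hdotZr.
(* Pointwise bound: the part of [x] orthogonal to the range is invisible to [z], and the rest is
   [A u], so ['[z, x] = '[u, adjoint A z]] is at most [|u|]. *)
- move=> x; have [[u _ uE] px] := orthoprojP x Acl.
  exists `|u| => _ [z [zA z1 ->]].
  have -> : '[z, x] = '[u, adjoint A z].
    rewrite -adjointP // uE; apply/eqP; rewrite hdotC -subr_eq0.
    by rewrite -hdotNl -hdotDl px.
  apply: le_trans (normr_hdot_le _ _) _.
  by rewrite -[leRHS]mulr1 ler_wpM2l.
exists (`|M| + 1) => [|y yA]; first by rewrite ltr_wpDl.
(* A vector [A u] killed by the adjoint vanishes, since [|A u|^2 = '[u, adjoint A (A u)]]. *)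
have [y0|y0] := eqVneq (adjoint A y) 0.
  rewrite y0 normr0 mulr0 normr_le0 -normr_eq0 -sqrf_eq0 normr_hdot.
  case: yA y0 => u _ <- y0.
  by rewrite adjointP // y0 hdotC hdot0l.
have [->|yn0] := eqVneq y 0; first by rewrite normr0 mulr_ge0 // addr_ge0.
have ny : 0 < `|y| by rewrite normr_gt0.
have nA : 0 < `|adjoint A y| by rewrite normr_gt0.
pose z := `|adjoint A y|^-1 *: y.
(* The left side equals [|y| / |adjoint A y|], which gives the bound sought. *)
have : `|'[z, `|y|^-1 *: y]| <= M.
  apply: (HM (hdot z)); last by rewrite normrZ normfV normr_id mulVf // gt_eqF.
  exists z; split=> //.
    by case: yA => u _ yE; exists (`|adjoint A y|^-1 *: u); rewrite ?linearZ ?yE.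
  have [adj adjE] := linear_bundle (adjoint_linear Ac).
  by rewrite adjE linearZ -adjE normrZ normfV normr_id mulVf // gt_eqF.
rewrite hdotZl hdotZr -normr_hdot expr2 !normrM !normfV !normr_id mulKf ?gt_eqF //.
rewrite mulrC ler_pdivrMr // => /le_trans; apply.
by rewrite ler_wpM2r // (le_trans (ler_norm _)) // lerDl.
Qed.

Lemma BBadj_linear (U E : hilbertType R) (A : {linear U -> E}) : continuous A ->
  linear (BBadj A).
Proof. by move=> Ac a x y; rewrite /BBadj /= adjoint_linear // linearP. Qed.

Lemma hdot_BBadj (U E : hilbertType R) (B : {linear U -> E}) (x y : E) :
  continuous B -> '[BBadj B x, y] = '[adjoint B x, adjoint B y].
Proof. by move=> Bc; rewrite adjointP. Qed.

(** The adjoint inherits the bound [k] of [B], because [|B^* x|^2 = '[B B^* x, x] <= k |B^* x|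
    |x|]. *)
Lemma BBadj_bounded (U E : hilbertType R) (B : {linear U -> E}) : continuous B ->
  exists2 k, 0 < k & forall x, `|BBadj B x| <= k * `|x|.
Proof.
move=> Bc; have [k k0 kP] := linear_lipschitz Bc.
exists (k * k) => [|x]; first exact: mulr_gt0.
apply: le_trans (kP _) _; rewrite -mulrA ler_pM2l //.
apply: ler_norm_of_sqr; first by rewrite mulr_ge0 // ltW.
rewrite normr_hdot -adjointP //; apply: le_trans (hdot_le _ _) _.
by rewrite mulrAC ler_wpM2r.
Qed.

End BoundedOperators.

(** * Inversion of [I - a S] for small [a] *)

Section Resolvent.
Context {R : realType} {E : hilbertType R}.

(** As [a S] is a contraction, [x - a S x = y] has as its solution the fixed point of
    [x |-> y + a S x]. Uniqueness of the solution yields both the linearity of [Ti] and the left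
    inverse property. *)
Lemma resolvent_exists (S : {linear E -> E}) (a k : R) :
  0 <= a -> 0 <= k -> a * k < 1 -> (forall x, `|S x| <= k * `|x|) ->
  exists Ti : {linear E -> E},
    (forall x, Ti x - a *: S (Ti x) = x) /\ (forall x, Ti (x - a *: S x) = x).
Proof.
move=> a0 k0 ak1 Sk.
have T_inj x y : x - a *: S x = y - a *: S y -> x = y.
  move=> xy; apply/eqP; rewrite -subr_eq0 -normr_le0.
  have e : x - y = a *: S (x - y).
    rewrite linearB scalerBr -{1}[x](subrK (a *: S x)) xy.
    by rewrite addrAC (addrAC y) subrr add0r addrC.
  have : `|x - y| <= a * k * `|x - y|.
    by rewrite {1}e normrZ ger0_norm // -mulrA ler_wpM2l.
  have := normr_ge0 (x - y); nra.
have T_surj y : exists x, x - a *: S x = y.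
  pose f : {fun [set: E] >-> [set: E]} := totalfun (fun x => y + a *: S x).
  have cf : is_contraction f.
    have ak0 : 0 <= a * k by rewrite mulr_ge0.
    exists (NngNum ak0); split=> //= -[u v] _ /=.
    rewrite opprD addrACA subrr add0r -scalerBr -linearB normrZ ger0_norm //.
    by rewrite -mulrA ler_wpM2l.
  have [|x _ xf] := banach_fixed_point cf closedT; first by exists 0.
  by exists x; rewrite {1}xf /= addrK.
have [Ti TiP] := choice T_surj.
have [|g gE] := @linear_bundle _ _ _ Ti.
  move=> c x y; apply: T_inj; rewrite TiP linearP.
  by rewrite scalerDr opprD addrACA TiP scalerA mulrC -scalerA -scalerBr TiP.
rewrite {}gE in TiP.
by exists g; split=> // x; apply: T_inj; rewrite TiP.
Qed.

End Resolvent.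

(** * Derivatives of curves and a mean value inequality *)

Section Derivatives.
Context {R : realType}.

Lemma is_derive_cvg (V : normedModType R) (f : R -> V) (t : R) (df : V) :
  is_derive t 1 f df <-> h^-1 *: (f (h + t) - f t) @[h --> 0^'] --> df.
Proof.
have E : (fun h => h^-1 *: ((f \o shift t) (h *: 1) - f t)) =
    (fun h => h^-1 *: (f (h + t) - f t)).
  by apply/funext => h; rewrite /= (_ : h%:A = h) //; exact: mulr1.
split=> [[fd <-]|fd]; first by have := fd; rewrite /derivable /derive E.
split; first by rewrite /derivable E; apply/cvg_ex; exists df.
by rewrite /derive E; exact/cvg_lim.
Qed.

(** Increments smaller than [t] in size never leave the half-line, so the restriction to it is
    harmless; hence the radius [Num.min e t] below. *)
Lemma is_derive_ge0_gt0 (V : normedModType R) (f : R -> V) (t : R) (df : V) :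
  0 < t -> is_derive_ge0 f t df -> is_derive t 1 f df.
Proof.
move=> t0 fd; apply/is_derive_cvg.
have -> : (fun h => h^-1 *: (f (h + t) - f t)) =
    (fun s => (s - t)^-1 *: (f s - f t)) \o (fun h => h + t).
  by apply/funext => h /=; rewrite addrK.
apply: cvg_comp fd => P /nbhs_ballP[e /= e0 eP].
apply/nbhs_ballP; exists (Num.min e t) => /=; first by rewrite lt_min e0.
move=> h; rewrite -ball_normE /ball_ /= sub0r normrN lt_min => /andP[he ht] h0.
apply: eP.
- by rewrite -ball_normE /ball_ /= opprD addrCA subrr addr0 normrN.
- by rewrite -subr_eq0 addrK.
by rewrite /= in_itv /= andbT; move: ht; rewrite ltr_norml; lra.
Qed.

Lemma is_derive_within_continuous (V : normedModType R) (f df : R -> V) (a b : R) :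
  (forall x, a <= x <= b -> is_derive x 1 f (df x)) ->
  {within `[a, b], continuous f}.
Proof.
move=> fd; apply: derivable_within_continuous => x; rewrite in_itv /= => xab.
by have [] := fd x xab.
Qed.

Context {E : hilbertType R}.

Lemma is_derive_hdot (f g : R -> E) (t : R) (df dg : E) :
  is_derive t 1 f df -> is_derive t 1 g dg ->
  is_derive t 1 (fun s => '[f s, g s]) ('[df, g t] + '[f t, dg]).
Proof.
move=> fd gd; apply/is_derive_cvg.
have gc : g (h + t) @[h --> 0^'] --> g t.
  have [gdv _] := gd.
  have := differentiable_continuous ((derivable1_diffP _ _).1 gdv).
  move=> gct; apply: cvg_within_filter.
  apply: (@cvg_comp _ _ _ (fun h => h + t) g _ (nbhs t)) => //.
  have : h + t @[h --> (0 : R)] --> 0 + t by apply: cvgD; [exact: cvg_id|exact: cvg_cst].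
  by rewrite add0r.
move/is_derive_cvg in fd; move/is_derive_cvg in gd.
have -> : (fun h => h^-1 *: ('[f (h + t), g (h + t)] - '[f t, g t])) =
  (fun h => '[h^-1 *: (f (h + t) - f t), g (h + t)] +
            '[f t, h^-1 *: (g (h + t) - g t)]).
  by apply/funext => h; rewrite [LHS]mulrC !hdotE; ring.
by apply: cvgD; apply: cvg_hdot => //; exact: cvg_cst.
Qed.

Lemma is_derive_linear (V W : normedModType R) (S : {linear V -> W})
    (f : R -> V) (t : R) (df : V) :
  continuous S -> is_derive t 1 f df -> is_derive t 1 (S \o f) (S df).
Proof.
move=> Sc /is_derive_cvg fd; apply/is_derive_cvg.
have -> : (fun h => h^-1 *: ((S \o f) (h + t) - (S \o f) t)) =
    S \o (fun h => h^-1 *: (f (h + t) - f t)).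
  by apply/funext => h /=; rewrite [RHS]linearZZ [in RHS]linearB.
exact: (cvg_comp _ S fd (Sc _)).
Qed.

Lemma is_derive_diff_comp (V W : normedModType R) (F : V -> W) (f : R -> V)
    (t : R) (df : V) :
  differentiable F (f t) -> is_derive t 1 f df ->
  is_derive t 1 (F \o f) ('d F (f t) df).
Proof.
move=> Fd [fd dfE]; move/derivable1_diffP in fd.
have Ffd : differentiable (F \o f) t by exact: differentiable_comp.
split; first exact/derivable1_diffP.
by rewrite deriveE // diff_comp //= -dfE deriveE.
Qed.

(** The vector-valued inequality reduces to the scalar mean value theorem for [s |->
    '[f s - s w, e]], where [e] is the very vector to be bounded: its increment is [|e|^2]. *)
Lemma mean_value_le (f df : R -> E) (a b M : R) (w : E) : a < b ->
  (forall x, a <= x <= b -> is_derive x 1 f (df x)) ->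
  (forall x, a <= x <= b -> `|df x - w| <= M) ->
  `|f b - f a - (b - a) *: w| <= M * (b - a).
Proof.
move=> ab fd dfM; set e := f b - f a - (b - a) *: w.
pose g s := '[f s - s *: w, e].
have gd x : a <= x <= b -> is_derive x 1 g ('[df x - w, e]).
  move=> xab.
  have fx := fd x xab.
  have := @is_derive_hdot (fun s => f s - s *: w) (cst e) x (df x - w) 0.
  rewrite (hdotC _ 0) hdot0l addr0; apply.
  apply: is_deriveB.
  apply/is_derive_cvg.
  apply: (@cvg_near_cst _ _ _ _ _).
  rewrite near_withinE; near=> h => /= h0.
  by rewrite scalerDl addrK scalerA mulVf // scale1r.
have M0 : 0 <= M by apply: le_trans (dfM a _); rewrite // lexx ltW.
have [c cab gE] := MVT ab (fun x xab => gd x (subset_itv_oo_cc xab))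
  (is_derive_within_continuous gd).
have eE : g b - g a = `|e| ^+ 2.
  rewrite normr_hdot /g -hdotNl -hdotDl; congr '[_, _].
  by rewrite /e scalerBl !opprB addrACA [RHS]addrACA (addrC (- _)).
apply: ler_norm_of_sqr; first by rewrite mulr_ge0 // subr_ge0 ltW.
rewrite -eE gE mulrAC ler_wpM2r ?subr_ge0 ?(ltW ab) //.
apply: le_trans (hdot_le _ _) _; rewrite ler_wpM2r // dfM //.
exact: (subset_itv_oo_cc cab).
Unshelve. all: by end_near. Qed.

End Derivatives.

(** * Convergence criteria at infinity *)

Section Asymptotics.
Context {R : realType}.

Lemma cvg0_pinftyP (V : normedModType R) (f : R -> V) :
  f t @[t --> +oo] --> (0 : V) <->
  forall e, 0 < e -> exists2 t0, 1 <= t0 & forall t, t0 <= t -> `|f t| < e.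
Proof.
split=> [/cvgr0Pnorm_lt f0 e e0|f0].
  have [a [_ aP]] := f0 e e0.
  exists (Num.max 1 (a + 1)) => [|t]; first by rewrite le_max lexx.
  by rewrite ge_max => /andP[_ at_]; apply: aP; lra.
apply/cvgr0Pnorm_lt => e e0; have [t0 _ t0P] := f0 e e0.
by exists t0; split=> [|t /ltW]; [exact: num_real|exact: t0P].
Qed.

Context {E : hilbertType R}.

(* If |V t| >= e for some late t, then |V| >= e / 2 on an interval of fixed
   length, on which h falls by a fixed amount below its infimum. *)
Lemma dissipation_cvg0 (h dh : R -> R) (V dV : R -> E) (eta low M : R) :
  0 < eta -> 0 < M ->
  (forall t : R, 1 <= t -> is_derive t 1 h (dh t)) ->
  (forall t : R, 1 <= t -> dh t <= - eta * `|V t| ^+ 2) ->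
  (forall t : R, 1 <= t -> low <= h t) ->
  (forall t : R, 1 <= t -> is_derive t 1 V (dV t)) ->
  (forall t : R, 1 <= t -> `|dV t| <= M) ->
  V t @[t --> +oo] --> (0 : E).
Proof.
move=> eta0 M0 hd dhle lowh Vd VM.
pose A := [set h t | t in [set t | 1 <= t]].
have hA : has_inf A.
  by split; [exists (h 1), 1 => //=|exists low => _ [t /= t1 <-]; exact: lowh].
have step s t : 1 <= s -> s < t -> exists2 c, s <= c <= t & h t = h s + dh c * (t - s).
  move=> s1 st.
  have hd' x : s <= x <= t -> is_derive x 1 h (dh x).
    by move=> /andP[sx _]; apply: hd; exact: le_trans sx.
  have [c cst e] := MVT st (fun x xst => hd' x (subset_itv_oo_cc xst))
    (is_derive_within_continuous hd').
  by exists c; [exact: (subset_itv_oo_cc cst)|rewrite -e addrC subrK].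
apply/cvg0_pinftyP => e e0.
(* During a time [d] the norm of [V] falls by at most [M * d = e / 2]. *)
pose d := e / (2 * M).
have d0 : 0 < d by rewrite divr_gt0 // mulr_gt0.
have Md : M * d = e / 2 by rewrite /d; field; rewrite gt_eqF.
pose drop := eta * (e / 2) ^+ 2 * d.
have drop0 : 0 < drop.
  apply: mulr_gt0 => //; apply: mulr_gt0 => //.
  by rewrite exprn_gt0 // divr_gt0.
(* From [t0] on, [h] is within [drop] of its infimum, so it cannot lose another [drop]. *)
have [_ [t0 /= t01 <-] ht0] := inf_adherent drop0 hA.
exists t0 => // t t0t; rewrite ltNge; apply/negP => eV.
have t1 : 1 <= t by exact: le_trans t0t.
have htt0 : h t <= h t0.
  have [->//|t0nt] := eqVneq t t0.
  have [|c /andP[t0c _] ->] := step t0 t t01; first by rewrite lt_neqAle eq_sym t0nt.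
  rewrite gerDl mulr_le0_ge0 ?subr_ge0 //.
  apply: le_trans (dhle c (le_trans t01 t0c)) _.
  by rewrite mulNr oppr_le0 mulr_ge0 ?sqr_ge0 ?ltW.
have [|c /andP[tc ctd] hE] := step t (t + d) t1; first by rewrite ltrDl.
have Vc : e / 2 <= `|V c|.
  have [<-|tnc] := eqVneq t c; first by apply: le_trans eV; lra.
  have tltc : t < c by rewrite lt_neqAle tnc.
  have Vd' x : t <= x <= c -> is_derive x 1 V (dV x).
    by move=> /andP[tx _]; apply: Vd; exact: le_trans tx.
  have VM' x : t <= x <= c -> `|dV x - 0| <= M.
    by move=> /andP[tx _]; rewrite subr0; apply: VM; exact: le_trans tx.
  have := mean_value_le tltc Vd' VM'; rewrite scaler0 subr0.
  have : M * (c - t) <= e / 2 by rewrite -Md ler_pM2l // lerBlDl.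
  have := lerB_dist (V t) (V c); rewrite distrC; lra.
have : inf A <= h (t + d).
  by apply: (ge_inf hA.2); exists (t + d) => //=; rewrite ler_wpDr // ltW.
have : dh c * d <= - drop.
  rewrite /drop -mulNr ler_pM2r //.
  apply: le_trans (dhle c (le_trans t1 tc)) _.
  by rewrite !mulNr lerN2 ler_pM2l // ler_pXn2r ?nnegrE // divr_ge0 // ltW.
by rewrite hE addrAC subrr add0r; lra.
Qed.

(** A Barbalat argument: over a short interval [W] is nearly constant and [r] is small, so
    [V (t + d) - V t] is close to [- d W t]; since [V] tends to 0, so must [W]. *)
Lemma derivative_remainder_cvg0 (V W r : R -> E) :
  (forall t : R, 1 <= t -> is_derive t 1 V (r t - W t)) ->
  V t @[t --> +oo] --> (0 : E) -> r t @[t --> +oo] --> (0 : E) ->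
  (forall e, 0 < e -> exists2 d, 0 < d &
     forall s t, 1 <= t -> t <= s <= t + d -> `|W s - W t| <= e) ->
  W t @[t --> +oo] --> (0 : E).
Proof.
move=> Vd /cvg0_pinftyP V0 /cvg0_pinftyP r0 Wuc.
apply/cvg0_pinftyP => e e0.
have e40 : 0 < e / 4 by rewrite divr_gt0.
have [d d0 dP] := Wuc _ e40.
(* Budget: the two values of [V] contribute less than [e d / 4] and the mean value error at most
   [e d / 2], together less than [e d]. *)
have [|t1 t11 t1P] := V0 (e / 4 * d / 2); first by rewrite !mulr_gt0.
have [t2 t21 t2P] := r0 _ e40.
exists (Num.max t1 t2) => [|t]; first by rewrite le_max t11.
rewrite ge_max => /andP[t1t t2t].
have tge : 1 <= t by exact: le_trans t1t.
have ttd : t < t + d by rewrite ltrDl.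
have Vd' x : t <= x <= t + d -> is_derive x 1 V (r x - W x).
  by move=> /andP[tx _]; apply: Vd; exact: le_trans tx.
have dM x : t <= x <= t + d -> `|r x - W x - (- W t)| <= e / 2.
  move=> xtd; have -> : r x - W x - - W t = r x - (W x - W t).
    by rewrite opprK opprB addrA addrAC.
  have /andP[tx _] := xtd.
  have := t2P x (le_trans t2t tx); have := dP x t tge xtd.
  have := ler_normB (r x) (W x - W t).
  lra.
have := mean_value_le ttd Vd' dM.
have -> : t + d - t = d by rewrite addrC addKr.
rewrite scalerN opprK.
have := t1P t t1t; have := t1P (t + d) (le_trans t1t (ltW ttd)).
have := ler_normB (V (t + d) - V t + d *: W t) (V (t + d) - V t).
have -> : V (t + d) - V t + d *: W t - (V (t + d) - V t) = d *: W t.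
  by rewrite addrC addKr.
rewrite normrZ (gtr0_norm d0).
have := ler_normB (V (t + d)) (V t).
move=> h1 h2 h3 h4 h5; rewrite -(ltr_pM2l d0); nra.
Qed.

End Asymptotics.

(** * The abstract damped system, with [S] for [B B^*] and [Ti] for the inverse of [T] *)

Section DampedDynamics.
Context {R : realType} {E : hilbertType R}.
Context (S Ti : {linear E -> E}) (a k : R).
Context (a_ge0 : 0 <= a) (k_ge0 : 0 <= k) (ak_lt1 : a * k < 1).
Context (S_le : forall x, `|S x| <= k * `|x|) (S_sym : self_adjoint S).
Context (TiK : forall x, Ti x - a *: S (Ti x) = x).
Context (TK : forall x, Ti (x - a *: S x) = x).

Let T x := x - a *: S x.

Lemma hdot_T x y : '[T x, Ti y] = '[x, y].
Proof.
by rewrite /T hdotDl hdotNl hdotZl S_sym -{3}(TiK y) hdotDr hdotNr hdotZr.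
Qed.

Lemma Ti_sym x y : '[Ti x, y] = '[x, Ti y].
Proof. by rewrite -{2}(TiK x) hdot_T. Qed.

Lemma Ti_comm x : Ti (S x) = S (Ti x).
Proof. by rewrite -{1}(TiK x) linearB linearZ TK. Qed.

Lemma T_le x : `|T x| <= 2 * `|x|.
Proof.
apply: le_trans (ler_normB _ _) _; rewrite normrZ ger0_norm //.
have : a * `|S x| <= a * (k * `|x|) by rewrite ler_wpM2l.
have : a * k * `|x| <= 1 * `|x| by rewrite ler_wpM2r // ltW.
rewrite mulrA; lra.
Qed.

(** With [x = T (Ti x)] this is the bound [T >= 1 - a k] at the point [Ti x]. *)
Lemma Ti_hdot_ge x : (1 - a * k) * `|Ti x| ^+ 2 <= '[Ti x, x].
Proof.
rewrite -{3}(TiK x) hdotDr hdotNr hdotZr -normr_hdot.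
have h : '[Ti x, S (Ti x)] <= k * `|Ti x| ^+ 2.
  apply: le_trans (hdot_le _ _) _.
  by rewrite mulrC expr2 mulrA ler_wpM2r.
have : a * '[Ti x, S (Ti x)] <= a * (k * `|Ti x| ^+ 2) by rewrite ler_wpM2l.
lra.
Qed.

(** The factor 4 is the square of the bound 2 on [T], through [|x| = |T (Ti x)| <= 2 |Ti x|]. *)
Lemma Ti_coercive x : (1 - a * k) / 4 * `|x| ^+ 2 <= '[Ti x, x].
Proof.
apply: le_trans (Ti_hdot_ge x).
have x2 : `|x| ^+ 2 <= 4 * `|Ti x| ^+ 2.
  have -> : 4 * `|Ti x| ^+ 2 = (2 * `|Ti x|) ^+ 2 by ring.
  by rewrite ler_pXn2r ?nnegrE ?mulr_ge0 // -{1}(TiK x) T_le.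
rewrite -mulrA ler_pM2l ?subr_gt0 //; lra.
Qed.

Lemma Ti_le x : `|Ti x| <= (1 - a * k)^-1 * `|x|.
Proof.
have ak : 0 < 1 - a * k by rewrite subr_gt0.
rewrite mulrC ler_pdivlMr // mulrC.
have [->|n0] := eqVneq (Ti x) 0; first by rewrite normr0 mulr0.
have n1 : 0 < `|Ti x| by rewrite normr_gt0.
rewrite -(ler_pM2r n1) -mulrA -expr2 [leRHS]mulrC.
exact: le_trans (Ti_hdot_ge x) (hdot_le _ _).
Qed.

(* With z = Ti (S x), the difference of the two sides is a '[z, z - a S z]. *)
Lemma hdot_S_le_TiS x : '[S x, x] <= '[Ti (S x), x].
Proof.
set z := Ti (S x).
have zE : S x = z - a *: S z by rewrite TiK.
rewrite {1}zE hdotDl hdotNl hdotZl gerDl oppr_le0 mulr_ge0 //.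
rewrite S_sym; apply: le_trans (Ti_hdot_ge (S x)).
by rewrite mulr_ge0 ?sqr_ge0 // subr_ge0 ltW.
Qed.

Context (F : E -> R) (G : E -> E) (Psi : E -> {linear E -> E}) (Xhat : E).
Context (alpha gamma : R) (alpha_ge0 : 0 <= alpha) (gamma_ge0 : 0 <= gamma).
Context (F_diff : forall x, differentiable F x).
Context (dF : forall x h, 'd F x h = '[G x, h]).

(** [F] is a potential of the field [G]: [pot] itself in the first system, and [pot] minus the
    linear functional ['[gradient pot Xhat, -]] in the second. *)
Definition energy (x v : E) : R :=
  2^-1 * '[Ti v, v] + F x + gamma / 2 * '[Ti (S (x - Xhat)), x - Xhat].

Lemma energy_lower_bound x v :
  (1 - a * k) / 8 * `|v| ^+ 2 + F x + gamma / 2 * '[S (x - Xhat), x - Xhat]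
    <= energy x v.
Proof.
have := Ti_coercive v.
have : gamma / 2 * '[S (x - Xhat), x - Xhat] <=
    gamma / 2 * '[Ti (S (x - Xhat)), x - Xhat].
  by rewrite ler_wpM2l ?divr_ge0 // hdot_S_le_TiS.
rewrite /energy; lra.
Qed.

Context (X V : R -> E).
Context (X_derive : forall t : R, 1 <= t -> is_derive t 1 X (V t)).
Context (V_derive : forall t : R, 1 <= t -> is_derive t 1 V
  (- (alpha *: S (V t)) - T (Psi (X t) (V t) + G (X t))
   - gamma *: S (X t - Xhat))).

(** Pairing the equation with [Ti (V t)] cancels [T], so the [G] term offsets the derivative of [F];
    the [gamma] term offsets that of the quadratic part because [Ti] and [S] are symmetric and
    commute. *)
Lemma energy_derive (t : R) : 1 <= t ->
  is_derive t 1 (fun s => energy (X s) (V s))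
    (- (alpha * '[Ti (S (V t)), V t]) - '[V t, Psi (X t) (V t)]).
Proof.
move=> t1; have Xt := X_derive t1; have Vt := V_derive t1.
have Tic : continuous Ti by exact: bounded_continuous Ti_le.
have Sc : continuous S by exact: bounded_continuous S_le.
have Yt : is_derive t 1 (fun s => X s - Xhat) (V t).
  have := @is_deriveB _ _ _ X (cst Xhat) t 1 (V t) 0 Xt (is_derive_cst _ _ _).
  by rewrite subr0.
have d1 := is_derive_hdot (is_derive_linear Tic Vt) Vt.
have d2 := is_derive_diff_comp (F_diff (X t)) Xt.
have d3 := is_derive_hdot (is_derive_linear Tic (is_derive_linear Sc Yt)) Yt.
have d := is_deriveD (is_deriveD (is_deriveZ 2^-1 d1) d2) (is_deriveZ (gamma / 2) d3).
apply: (is_derive_eq d); rewrite dF /=.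
set w := - _ - _ - _.
have -> : '[Ti w, V t] = '[w, Ti (V t)] by rewrite Ti_sym.
have -> : '[Ti (V t), w] = '[w, Ti (V t)] by rewrite hdotC.
have -> : '[Ti (S (X t - Xhat)), V t] = '[S (X t - Xhat), Ti (V t)].
  by rewrite Ti_sym.
have -> : '[Ti (S (V t)), X t - Xhat] = '[S (X t - Xhat), Ti (V t)].
  by rewrite Ti_comm S_sym hdotC.
have -> : '[w, Ti (V t)] = - (alpha * '[Ti (S (V t)), V t])
   - ('[V t, Psi (X t) (V t)] + '[G (X t), V t])
   - gamma * '[S (X t - Xhat), Ti (V t)].
  rewrite /w hdotDl hdotDl !hdotNl !hdotZl hdot_T hdotDl Ti_sym.
  by rewrite (hdotC (Psi _ _)).
rewrite /GRing.scale /=; lra.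
Qed.

Context (eta low M : R) (eta_gt0 : 0 < eta).
Context (dissipative : forall x v,
  eta * `|v| ^+ 2 <= alpha * '[S v, v] + '[v, Psi x v]).
Context (energy_ge : forall x v, low <= energy x v).
Context (energy_coercive : forall h, exists m, forall x v, energy x v <= h ->
  [/\ `|v| <= m, `|G x| <= m & gamma * `|S (x - Xhat)| <= m]).
Context (Psi_le : forall x v, `|Psi x v| <= M * `|v|).
Context (G_unif : forall e, 0 < e -> exists2 d, 0 < d &
  forall x y, `|x - y| <= d -> `|G x - G y| <= e).

Lemma damped_dynamics_cvg :
  V t @[t --> +oo] --> (0 : E) /\
  G (X t) + gamma *: Ti (S (X t - Xhat)) @[t --> +oo] --> (0 : E).
Proof.
pose H s := energy (X s) (V s).
pose dH t := - (alpha * '[Ti (S (V t)), V t]) - '[V t, Psi (X t) (V t)].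
have dH_le (t : R) : 1 <= t ->
    dH t <= - eta * `|V t| ^+ 2.
  rewrite /dH => t1; have := dissipative (X t) (V t).
  have : alpha * '[S (V t), V t] <= alpha * '[Ti (S (V t)), V t].
    by rewrite ler_wpM2l // hdot_S_le_TiS.
  lra.
have H1 (t : R) : 1 <= t -> H t <= H 1.
  rewrite le_eqVlt => /predU1P[<-//|t1].
  have Hd (x : R) : 1 <= x <= t -> is_derive x 1 H (dH x).
    by move=> /andP[x1 _]; exact: energy_derive x1.
  have [c c1t e] := MVT t1 (fun x xt => Hd x (subset_itv_oo_cc xt))
    (is_derive_within_continuous Hd).
  rewrite -subr_le0 e mulr_le0_ge0 ?subr_ge0 ?(ltW t1) //.
  have /andP[c1 _] : 1 <= c <= t := subset_itv_oo_cc c1t.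
  apply: le_trans (dH_le c c1) _.
  by rewrite mulNr oppr_le0 mulr_ge0 ?sqr_ge0 // ltW.
(* The terms of the equation are bounded along the trajectory; [X t] itself is not claimed to be,
   since a degenerate [S] does not control it. *)
have [m mP] := energy_coercive (H 1).
have [Vm Gm Sm] : [/\ forall t : R, 1 <= t -> `|V t| <= m,
     forall t : R, 1 <= t -> `|G (X t)| <= m &
     forall t : R, 1 <= t -> gamma * `|S (X t - Xhat)| <= m].
  by split=> t /H1/mP[].
have m0 : 0 <= m by apply: le_trans (Vm 1 (lexx 1)).
pose M' := `|M|.
have PsiM x v : `|Psi x v| <= M' * `|v|.
  by apply: le_trans (Psi_le x v) _; rewrite ler_wpM2r // ler_norm.
have rest_le t : `|- (alpha *: S (V t)) - T (Psi (X t) (V t))| <=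
    (alpha * k + 2 * M') * `|V t|.
  apply: le_trans (ler_normB _ _) _; rewrite normrN normrZ ger0_norm //.
  have : alpha * `|S (V t)| <= alpha * (k * `|V t|) by rewrite ler_wpM2l.
  have := T_le (Psi (X t) (V t)); have := PsiM (X t) (V t); lra.
have TD x y : T (x + y) = T x + T y.
  by rewrite /T linearD scalerDr opprD addrACA.
have V0 : V t @[t --> +oo] --> (0 : E).
  (* The summands bound the friction and damping part, the [T (G (X t))] part and the [gamma] part;
     the final 1 makes the sum positive. *)
  apply: (@dissipation_cvg0 R E H dH V _ eta low
           ((alpha * k + 2 * M') * m + 2 * m + m + 1) eta_gt0 _ energy_derive dH_le _
           V_derive).
  - by rewrite ltr_wpDl // !addr_ge0 // mulr_ge0 // addr_ge0 // mulr_ge0 // normr_ge0.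
  - by move=> t _; exact: energy_ge.
  move=> t t1; rewrite TD opprD !addrA.
  apply: le_trans (ler_normB _ _) _; rewrite normrZ (ger0_norm gamma_ge0).
  have := Sm t t1; have := Gm t t1; have := T_le (G (X t)).
  have := ler_normB (- (alpha *: S (V t)) - T (Psi (X t) (V t))) (T (G (X t))).
  have := rest_le t.
  have : (alpha * k + 2 * M') * `|V t| <= (alpha * k + 2 * M') * m.
    by rewrite ler_wpM2l ?Vm // addr_ge0 // mulr_ge0 // normr_ge0.
  lra.
split=> //.
(* [W] is [T] applied to the expression whose limit is sought; the rest of [V'] is [O(|V t|)].
   Applying [Ti] at the end removes [T]. *)
pose W t := T (G (X t)) + gamma *: S (X t - Xhat).
have W0 : W t @[t --> +oo] --> (0 : E).
  apply: (@derivative_remainder_cvg0 R E V W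
     (fun t => - (alpha *: S (V t)) - T (Psi (X t) (V t)))) => //.
  - move=> t t1; apply: (is_derive_eq (V_derive t1)).
    by rewrite /W TD !opprD !addrA.
  - apply/cvg0_pinftyP => e e0; move/cvg0_pinftyP: V0.
    set N := alpha * k + 2 * M' in rest_le.
    have N1 : 0 < N + 1.
      by rewrite ltr_wpDl // addr_ge0 // mulr_ge0 // normr_ge0.
    move=> /(_ (e / (N + 1)) (divr_gt0 e0 N1))[t0 t01 t0P].
    exists t0 => // t /t0P; rewrite ltr_pdivlMr // => h.
    apply: le_lt_trans (rest_le t) _; apply: le_lt_trans h.
    by rewrite mulrC ler_wpM2l // lerDl.
  move=> e e0; have e40 : 0 < e / 4 by rewrite divr_gt0.
  have [d d0 dP] := G_unif e40.
  have N1 : 0 < gamma * k + 1 by rewrite ltr_wpDl // mulr_ge0.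
  have m1 : 0 < m + 1 by rewrite ltr_wpDl.
  (* The first entry keeps [T (G (X s) - G (X t))] below [2 * (e / 4)], the second keeps the [gamma]
     term below [e / 4]. Dividing by the speed bound [m + 1] turns [d'] into a time. *)
  pose d' := Num.min d (e / 4 / (gamma * k + 1)).
  have d'0 : 0 < d' by rewrite lt_min d0 divr_gt0.
  exists (d' / (m + 1)) => [|s t t1 /andP[ts std]]; first exact: divr_gt0.
  have Xst : `|X s - X t| <= d'.
    have [->|tns] := eqVneq s t; first by rewrite subrr normr0 ltW.
    have tls : t < s by rewrite lt_neqAle eq_sym tns.
    have Xd' x : t <= x <= s -> is_derive x 1 X (V x).
      by move=> /andP[tx _]; apply: X_derive; exact: le_trans tx.
    have Xm' x : t <= x <= s -> `|V x - 0| <= m + 1.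
      move=> /andP[tx _]; rewrite subr0 ler_wpDr //.
      by apply: Vm; exact: le_trans tx.
    have := mean_value_le tls Xd' Xm'; rewrite scaler0 subr0 => /le_trans; apply.
    by rewrite mulrC -ler_pdivlMr // lerBlDl.
  move: Xst; rewrite le_min => /andP[Xd]; rewrite ler_pdivlMr // => Xe.
  have -> : W s - W t = T (G (X s) - G (X t)) + gamma *: S (X s - X t).
    have -> : X s - X t = (X s - Xhat) - (X t - Xhat).
      by rewrite opprB addrA subrK.
    have TN x : T (- x) = - T x by rewrite /T linearN scalerN opprD.
    rewrite (linearB S (X s - Xhat)) scalerBr TD TN.
    by rewrite [RHS]addrACA -opprD.
  apply: le_trans (ler_normD _ _) _; rewrite normrZ (ger0_norm gamma_ge0).
  have := T_le (G (X s) - G (X t)); have := dP _ _ Xd.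
  have : gamma * `|S (X s - X t)| <= gamma * (k * `|X s - X t|).
    by rewrite ler_wpM2l.
  have := normr_ge0 (X s - X t); lra.
have -> : (fun t => G (X t) + gamma *: Ti (S (X t - Xhat))) = Ti \o W.
  by apply/funext => t; rewrite /= /W [RHS]linearD linearZ TK.
have Tic : continuous Ti by exact: bounded_continuous Ti_le.
have := @cvg_comp _ _ _ W Ti _ _ _ W0 (Tic 0).
by rewrite linear0.
Qed.

End DampedDynamics.

(** * Application to the two closed-loop systems *)

Section ClosedLoop.
Context {R : realType} {E U : hilbertType R} (B : {linear U -> E}).
Context (B_cont : continuous B).

(** For [p = 0] the bound on [r] is [+oo], and the conclusion is [0 < 1]. *)
Lemma mulr_lt1_of_lt_inve (r p : R) :
  0 <= p -> (r%:E < (p%:E)^-1)%E -> r * p < 1.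
Proof.
rewrite le_eqVlt inver => /predU1P[<-|p0]; first by rewrite mulr0.
by rewrite gt_eqF // lte_fin -[_^-1]div1r ltr_pdivlMr.
Qed.

Lemma c1_gt0 (rho dt c : R) : 0 < rho -> 0 < dt -> 0 <= c -> 0 < c1 rho dt c.
Proof.
move=> r0 d0 c0; apply: mulr_gt0; first by rewrite mulr_gt0 // exprn_gt0.
by rewrite ltr_wpDr // mulr_ge0 // sqr_ge0.
Qed.

Lemma c2_ge0 (rho dt c : R) : 0 < rho -> 0 < dt -> 0 <= c -> 0 <= c2 rho dt c.
Proof.
move=> r0 d0 c0; have -> : c2 rho dt c = dt * c1 rho dt c by rewrite /c2 /c1; ring.
by rewrite mulr_ge0 ?ltW // c1_gt0.
Qed.

Lemma BBadj_resolvent (a : R) : 0 <= a -> a * opnorm (BBadj B) < 1 ->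
  exists S Ti : {linear E -> E},
    [/\ BBadj B = S, 0 <= opnorm (BBadj B),
        forall x, `|S x| <= opnorm (BBadj B) * `|x|,
        (forall x, Ti x - a *: S (Ti x) = x) &
        (forall x, Ti (x - a *: S x) = x)].
Proof.
move=> a0; have [S SE] := linear_bundle (BBadj_linear B_cont).
have [k _ kP] := BBadj_bounded B_cont; rewrite SE in kP * => ak.
have Sc : continuous S by exact: bounded_continuous kP.
have [Ti [TiK TK]] := resolvent_exists a0 (opnorm_ge0 Sc) ak
  (fun x => opnorm_le x Sc).
exists S, Ti; split=> //; first exact: opnorm_ge0.
by move=> x; exact: opnorm_le.
Qed.

(** [pinv] chooses some preimage; injectivity of [opT] forces the choice to be [Ti]. *)
Lemma pinv_opT (Ti : E -> E) (rho dt c : R) :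
  (forall x, opT B rho dt c (Ti x) = x) -> (forall x, Ti (opT B rho dt c x) = x) ->
  pinv [set: E] (opT B rho dt c) = Ti.
Proof.
move=> TiK TK; apply/funext => y; rewrite -[LHS]TK pinvK //.
by apply/mem_set; exists (Ti y).
Qed.

(** Starting at time 1 avoids the one-sided derivative at 0 and does not affect limits at
    infinity. *)
Lemma solution_derive (Psi : E -> {linear E -> E}) (G : E -> E) (Xhat : E)
    (rho dt c : R) (X V : R -> E) :
  solution B Psi G Xhat rho dt c X V ->
  (forall t : R, 1 <= t -> is_derive t 1 X (V t)) /\
  (forall t : R, 1 <= t -> is_derive t 1 V
    (- (c1 rho dt c *: BBadj B (V t))
     - opT B rho dt c (Psi (X t) (V t) + G (X t))
     - c3 rho dt c *: BBadj B (X t - Xhat))).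
Proof.
move=> [_ _ Xd Vd]; have t_gt0 (t : R) : 1 <= t -> 0 < t by lra.
by split=> t /t_gt0 t0; apply: is_derive_ge0_gt0 => //;
  [apply: Xd|apply: Vd]; exact: ltW.
Qed.

Lemma damping_le (Psi : E -> {linear E -> E}) : damping Psi ->
  exists M, forall x v, `|Psi x v| <= M * `|v|.
Proof.
move=> [Psic [M MP] _ _]; exists M => x v.
apply: le_trans (opnorm_le v (Psic x)) _.
by rewrite ler_wpM2r //; apply: MP; exists x.
Qed.

Lemma BBadj_sym : self_adjoint (BBadj B).
Proof. by move=> x y; rewrite hdot_BBadj // [RHS]hdotC hdot_BBadj // hdotC. Qed.

Lemma sqnorm_adjoint x : `|adjoint B x| ^+ 2 = '[BBadj B x, x].
Proof. by rewrite hdot_BBadj // normr_hdot. Qed.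

(** A crude substitute for the square root, from [x <= x ^+ 2 + 1/4]. *)
Lemma sqr_le_bound (x A : R) : x ^+ 2 <= A -> x <= 1 + A.
Proof. by have := sqr_ge0 (x - 2^-1); nra. Qed.

(** Young's inequality, used to absorb a linear term into a quadratic one. *)
Lemma mulr_le_young (q x y : R) : 0 < q -> x * y <= q / 2 * y ^+ 2 + x ^+ 2 / (2 * q).
Proof.
move=> q0; rewrite -subr_ge0.
have -> : q / 2 * y ^+ 2 + x ^+ 2 / (2 * q) - x * y = (q * y - x) ^+ 2 / (2 * q).
  by field; rewrite gt_eqF.
by rewrite divr_ge0 ?sqr_ge0 // mulr_ge0 // ltW.
Qed.

(* Split v along E0: on E0 the adjoint of B is bounded below, off E0 the
   damping acts. *)
Lemma partial_damping_dissipative (Psi : E -> {linear E -> E}) (psi alpha : R)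
    (E0 : set E) : closed (range B) -> 0 < alpha -> 0 < psi ->
  closed_subspace E0 -> E0 `<=` range B ->
  (forall x v, psi * `|v - orthoproj E0 v| ^+ 2 <= '[v, Psi x v]) ->
  exists2 eta, 0 < eta & forall x v,
    eta * `|v| ^+ 2 <= alpha * '[BBadj B v, v] + '[v, Psi x v].
Proof.
move=> Bcl alpha0 psi0 E0cl E0B psiP.
have [b b0 bP] := adjoint_bounded_below B_cont Bcl.
have [k k0 kP] := BBadj_bounded B_cont.
have [adj adjE] := linear_bundle (adjoint_linear B_cont).
have b20 : 0 < 2 * b ^+ 2 by rewrite mulr_gt0 ?exprn_gt0.
have k20 : 0 < 1 + 2 * b ^+ 2 * k by rewrite ltr_wpDr // mulr_ge0 // ltW.
(* The denominators are the weights of [|adjoint B v|^2] and [|q|^2] in the bound [vb] on [|v|^2]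
   below. *)
pose eta := Num.min (alpha / (2 * b ^+ 2)) (psi / (1 + 2 * b ^+ 2 * k)).
have eta0 : 0 < eta by rewrite lt_min !divr_gt0.
exists eta => // x v.
have [pE0 pP] := orthoprojP v E0cl.
have := psiP x v.
set p := orthoproj E0 v in pE0 pP *; set q := v - p in pP *.
have vE : `|v| ^+ 2 = `|p| ^+ 2 + `|q| ^+ 2.
  by rewrite -[v](subrK p) -/q sqnormD pP // mulr0 addr0 addrC.
have pb : `|p| ^+ 2 <= b ^+ 2 * `|adjoint B p| ^+ 2.
  rewrite -exprMn ler_pXn2r ?nnegrE ?mulr_ge0 ?(ltW b0) //.
  exact/bP/E0B.
have qk : `|adjoint B q| ^+ 2 <= k * `|q| ^+ 2.
  rewrite sqnorm_adjoint; apply: le_trans (hdot_le _ _) _.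
  by rewrite expr2 mulrA ler_wpM2r.
have pq : `|adjoint B p| ^+ 2 <= 2 * `|adjoint B v| ^+ 2 + 2 * `|adjoint B q| ^+ 2.
  have -> : adjoint B p = adjoint B v - adjoint B q.
    by rewrite adjE -linearB /q subKr.
  have := sqr_ge0 `|adjoint B v + adjoint B q|.
  rewrite sqnormB sqnormD; lra.
have : eta * (2 * b ^+ 2) <= alpha by rewrite -ler_pdivlMr // ge_min lexx.
have : eta * (1 + 2 * b ^+ 2 * k) <= psi.
  by rewrite -ler_pdivlMr // ge_min lexx orbT.
rewrite -sqnorm_adjoint => e1 e2 Psiq.
have vb : `|v| ^+ 2 <= 2 * b ^+ 2 * `|adjoint B v| ^+ 2 +
    (1 + 2 * b ^+ 2 * k) * `|q| ^+ 2.
  have : b ^+ 2 * `|adjoint B p| ^+ 2 <=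
      b ^+ 2 * (2 * `|adjoint B v| ^+ 2 + 2 * (k * `|q| ^+ 2)).
    by rewrite ler_wpM2l ?sqr_ge0 //; lra.
  rewrite vE; lra.
have := ler_wpM2l (ltW eta0) vb.
have := ler_wpM2r (sqr_ge0 `|adjoint B v|) e2.
have := ler_wpM2r (sqr_ge0 `|q|) e1.
lra.
Qed.

Lemma closed_loop_partial_damping (pot : E -> R) (potlow : R)
    (Psi : E -> {linear E -> E}) (Xhat : E) (psi : R) (E0 : set E)
    (dt rho c : R) (X V : R -> E) :
  closed (range B) -> potential pot potlow -> damping Psi ->
  unif_continuous (gradient pot) ->
  0 < psi -> closed_subspace E0 -> E0 `<=` range B ->
  (forall x v, psi * `|v - orthoproj E0 v| ^+ 2 <= '[v, Psi x v]) ->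
  0 < dt -> 0 <= c -> 0 < rho ->
  c2 rho dt c * opnorm (BBadj B) < 1 ->
  solution B Psi (gradient pot) Xhat rho dt c X V ->
  V t @[t --> +oo] --> (0 : E) /\
  gradient pot (X t)
    + c3 rho dt c *:
        (pinv [set: E] (opT B rho dt c)) (BBadj B (X t - Xhat))
    @[t --> +oo] --> (0 : E).
Proof.
move=> Bcl [[pot_diff _] potP [C C0 gradC]] Psi_damp gradU psi0 E0cl E0B psiP
  dt0 c0 rho0 ak sol.
have [M MP] := damping_le Psi_damp.
have [Xd Vd] := solution_derive sol.
have a0 := c2_ge0 rho0 dt0 c0.
have [S [Ti [SE k0 Sk TiK TK]]] := BBadj_resolvent a0 ak.
have opTE : opT B rho dt c = fun x => x - c2 rho dt c *: S x.
  by rewrite /opT SE.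
have -> : pinv [set: E] (opT B rho dt c) = Ti by apply: pinv_opT; rewrite opTE.
have [eta eta0 dissip] := partial_damping_dissipative Bcl
  (c1_gt0 rho0 dt0 c0) psi0 E0cl E0B psiP.
have [kB kB0 kBP] := linear_lipschitz B_cont.
(* The energy controls ['[S y, y]] but not [y]; this inequality turns that into control of [S y]. *)
have Ssq x : `|S x| ^+ 2 <= kB ^+ 2 * '[S x, x].
  rewrite -SE -sqnorm_adjoint -exprMn.
  by rewrite ler_pXn2r ?nnegrE ?mulr_ge0 ?(ltW kB0) // kBP.
have Spos x : 0 <= '[S x, x] by rewrite -SE -sqnorm_adjoint sqr_ge0.
have Ssym : self_adjoint S by rewrite -SE; exact: BBadj_sym.
have g0 : 0 <= c3 rho dt c.
  by rewrite /c3 !mulr_ge0 ?exprn_ge0 // ltW.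
rewrite SE in dissip k0 Sk ak Vd *; rewrite opTE in Vd.
set a := c2 rho dt c in a0 ak TiK TK Vd; set k := opnorm S in k0 Sk ak.
set g := c3 rho dt c in g0 Vd *.
have lower := energy_lower_bound a0 ak Sk Ssym TiK pot Xhat g0.
have dpos : 0 < 1 - a * k by rewrite subr_gt0.
apply: (damped_dynamics_cvg a0 k0 ak Sk Ssym TiK TK (ltW (c1_gt0 rho0 dt0 c0)) g0
  pot_diff (fun x => gradientP (pot_diff x)) Xd Vd eta0 dissip (low := potlow) _ _ MP).
- move=> x v; apply: le_trans (lower x v).
  apply: le_trans (potP x) _; rewrite addrAC lerDr.
  by rewrite addr_ge0 // mulr_ge0 ?sqr_ge0 ?divr_ge0 ?(ltW dpos).
(* Kinetic term, [F - potlow] and quadratic term are nonnegative with sum at most [h - potlow];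
   [A1], [A2], [A3] are the resulting bounds on the three squared norms. *)
- move=> h; pose A1 := (h - potlow) * 8 / (1 - a * k).
  pose A2 := C * (1 + h - potlow); pose A3 := 2 * g * kB ^+ 2 * (h - potlow).
  exists (1 + Num.max A1 (Num.max A2 A3)) => x v hE.
  have := le_trans (lower x v) hE.
  have := potP x; have := Spos (x - Xhat).
  have s1 : 0 <= (1 - a * k) / 8 * `|v| ^+ 2.
    by rewrite mulr_ge0 ?sqr_ge0 ?divr_ge0 ?(ltW dpos).
  have s2 : 0 <= g / 2 * '[S (x - Xhat), x - Xhat] by rewrite mulr_ge0 ?divr_ge0.
  move=> s3 s4 s5.
  split; apply: sqr_le_bound; rewrite !le_max.
  + apply/orP; left; rewrite /A1 ler_pdivlMr //; lra.
  + apply/orP; right; apply/orP; left; apply: le_trans (gradC x) _.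
    by rewrite /A2 ler_pM2l //; lra.
  + apply/orP; right; apply/orP; right.
    rewrite exprMn.
    apply: (@le_trans _ _ (g ^+ 2 * (kB ^+ 2 * '[S (x - Xhat), x - Xhat]))).
      by rewrite ler_wpM2l ?sqr_ge0.
    have -> : g ^+ 2 * (kB ^+ 2 * '[S (x - Xhat), x - Xhat]) =
        2 * g * kB ^+ 2 * (g / 2 * '[S (x - Xhat), x - Xhat]) by field.
    rewrite /A3 ler_wpM2l ?mulr_ge0 ?sqr_ge0 //; lra.
move=> e e0; have [d d0 dP] := (unif_continuousP _).1 gradU e e0.
exists (d / 2) => [|x y xy]; first by rewrite divr_gt0.
have := dP (x, y); rewrite -!ball_normE /ball_ /= => h.
by apply/ltW/h; apply: le_lt_trans xy _; lra.
Qed.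

Lemma closed_loop_surjective (pot : E -> R) (potlow : R)
    (Psi : E -> {linear E -> E}) (Xhat : E) (L b : R)
    (dt rho c : R) (X V : R -> E) :
  0 <= L -> 0 < b -> (forall y, `|y| <= b * `|adjoint B y|) ->
  potential pot potlow -> damping Psi ->
  L.-lipschitz (gradient pot) ->
  0 < dt -> 0 <= c -> 0 < rho -> L * b ^+ 2 < c3 rho dt c ->
  c2 rho dt c * opnorm (BBadj B) < 1 ->
  solution B Psi (fun x => gradient pot x - gradient pot Xhat) Xhat
    rho dt c X V ->
  V t @[t --> +oo] --> (0 : E) /\ X t @[t --> +oo] --> Xhat.
Proof.
move=> L0 b0 bP [[pot_diff _] potP _] Psi_damp gradL dt0 c0 rho0 Lg ak sol.
have [M MP] := damping_le Psi_damp.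
have [Xd Vd] := solution_derive sol.
have a0 := c2_ge0 rho0 dt0 c0; have alpha0 := c1_gt0 rho0 dt0 c0.
have [S [Ti [SE k0 Sk TiK TK]]] := BBadj_resolvent a0 ak.
have opTE : opT B rho dt c = fun x => x - c2 rho dt c *: S x.
  by rewrite /opT SE.
have b20 : 0 < b ^+ 2 by rewrite exprn_gt0.
have Sb x : `|x| ^+ 2 <= b ^+ 2 * '[S x, x].
  rewrite -SE -sqnorm_adjoint -exprMn.
  by rewrite ler_pXn2r ?nnegrE ?mulr_ge0 ?(ltW b0).
have Ssym : self_adjoint S by rewrite -SE; exact: BBadj_sym.
have gradLP x y : `|gradient pot x - gradient pot y| <= L * `|x - y|.
  exact: (gradL (x, y)).
rewrite SE in k0 Sk ak Vd *; rewrite opTE in Vd.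
set a := c2 rho dt c in a0 ak TiK TK Vd; set k := opnorm S in k0 Sk ak.
set g := c3 rho dt c in Lg Vd *.
have g0 : 0 < g by apply: le_lt_trans Lg; rewrite mulr_ge0 // ltW.
set v0 := gradient pot Xhat in Vd *.
(* The tilted potential, with gradient zero at [Xhat]. It may be unbounded below, which the
   quadratic term of the energy has to make up for. *)
pose F x := pot x - '[v0, x].
have [l lE] : exists l : {linear E -> R}, hdot v0 = l.
  by apply: linear_bundle => r x y; rewrite hdotDr hdotZr.
have lc : continuous l.
  by apply: (@bounded_continuous _ _ _ _ `|v0|) => x; rewrite -lE normr_hdot_le.
have F_diff x : differentiable F x.
  have -> : F = pot - (l : E -> R) by rewrite -lE.
  by apply: differentiableB => //; exact: linear_differentiable.
have dF x h : 'd F x h = '[gradient pot x - v0, h].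
  have -> : F = pot - (l : E -> R) by rewrite -lE.
  rewrite diffB //; last exact: linear_differentiable.
  by rewrite /= diff_lin // gradientP // hdotDl hdotNl -lE.
have dpos : 0 < 1 - a * k by rewrite subr_gt0.
have [q q0 gE] : exists2 q, 0 < q & g / 2 = q * b ^+ 2.
  exists (g / (2 * b ^+ 2)); first by rewrite divr_gt0 // mulr_gt0.
  by field; rewrite gt_eqF.
have q20 : 0 <= q / 2 by rewrite divr_ge0 // ltW.
have p80 : 0 <= (1 - a * k) / 8 by rewrite divr_ge0 // ltW.
(* By coercivity of [S] the quadratic term is at least [q |x - Xhat|^2]. Half of it pays for
   ['[v0, x - Xhat]] by Young, and [D] collects the constants left over. *)
pose D := `|v0| ^+ 2 / (2 * q) + `|v0| * `|Xhat| - potlow.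
have lower x v : (1 - a * k) / 8 * `|v| ^+ 2 + q / 2 * `|x - Xhat| ^+ 2 - D
    <= energy S Ti F Xhat g x v.
  apply: le_trans (energy_lower_bound a0 ak Sk Ssym TiK F Xhat (ltW g0) x v).
  have h1 : q * `|x - Xhat| ^+ 2 <= g / 2 * '[S (x - Xhat), x - Xhat].
    by rewrite gE -mulrA ler_pM2l.
  have h2 : '[v0, x] <= `|v0| * `|x - Xhat| + `|v0| * `|Xhat|.
    rewrite -{1}[x](subrK Xhat) hdotDr.
    by apply: lerD; exact: hdot_le.
  have h3 : `|v0| * `|x - Xhat| <= q / 2 * `|x - Xhat| ^+ 2 + `|v0| ^+ 2 / (2 * q)
    by exact: mulr_le_young.
  have := potP x; rewrite /F /D; lra.
clearbody D.
have [V0 W0] : V t @[t --> +oo] --> (0 : E) /\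
    gradient pot (X t) - v0 + g *: Ti (S (X t - Xhat)) @[t --> +oo] --> (0 : E).
  apply: (damped_dynamics_cvg a0 k0 ak Sk Ssym TiK TK (ltW alpha0) (ltW g0)
    F_diff dF Xd Vd (eta := c1 rho dt c / b ^+ 2) _ _ (low := - D) _ _ MP).
  - by rewrite divr_gt0.
  (* The [Psi] term is only nonnegative; the coercivity of [S] alone provides the rate. *)
  - move=> x v; rewrite ler_wpDr //; first by case: Psi_damp => _ _ _; exact.
    by rewrite -mulrA ler_pM2l // mulrC ler_pdivrMr // [leRHS]mulrC; exact: Sb.
  - move=> x v; apply: le_trans (lower x v); rewrite lerDr.
    by apply: addr_ge0; rewrite mulr_ge0 ?sqr_ge0 ?p80 ?q20.
  - move=> h; pose A1 := 1 + (h + D) * 8 / (1 - a * k).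
    pose A2 := 1 + (h + D) * 2 / q.
    exists (Num.max A1 (Num.max (L * A2) (g * k * A2))) => x v hE.
    have := le_trans (lower x v) hE.
    have s1 : 0 <= (1 - a * k) / 8 * `|v| ^+ 2.
      by rewrite mulr_ge0 ?sqr_ge0 ?p80.
    have s2 : 0 <= q / 2 * `|x - Xhat| ^+ 2.
      by rewrite mulr_ge0 ?sqr_ge0 ?divr_ge0 ?(ltW q0).
    move=> s3.
    have y2 : `|x - Xhat| <= A2.
      by apply: sqr_le_bound; rewrite ler_pdivlMr //; lra.
    split; rewrite !le_max.
    + apply/orP; left; apply: sqr_le_bound.
      by rewrite ler_pdivlMr //; lra.
    + apply/orP; right; apply/orP; left; apply: le_trans (gradLP _ _) _.
      by rewrite ler_wpM2l.
    + apply/orP; right; apply/orP; right; rewrite -mulrA ler_pM2l //.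
      by apply: le_trans (Sk _) _; rewrite ler_wpM2l.
  move=> e e0; exists (e / (L + 1)) => [|x y xy].
    by rewrite divr_gt0 // ltr_wpDl.
  rewrite opprB addrA subrK; apply: le_trans (gradLP _ _) _.
  move: xy; rewrite ler_pdivlMr ?ltr_wpDl // => xy.
  by have := normr_ge0 (x - y); lra.
split=> //.
have Y0 : X t - Xhat @[t --> +oo] --> (0 : E).
  apply/cvg0_pinftyP => e e0; move/cvg0_pinftyP: W0.
  have gap : 0 < g - L * b ^+ 2 by rewrite subr_gt0.
  move=> /(_ ((g - L * b ^+ 2) / b ^+ 2 * e))[|t0 t01 t0P].
    by rewrite mulr_gt0 // divr_gt0.
  exists t0 => // t /t0P.
  set w := _ + _; set y := X t - Xhat => wlt.
  have [->|y0] := eqVneq y 0; first by rewrite normr0.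
  have ny : 0 < `|y| by rewrite normr_gt0.
  (* Testing [w] against [y] gives [(g - L b^2) |y| <= b^2 |w|], which explains the threshold
     imposed on [w]. *)
  have : g * `|y| ^+ 2 <= b ^+ 2 * (`|w| * `|y| + L * `|y| * `|y|).
    apply: (@le_trans _ _ (b ^+ 2 * (g * '[Ti (S y), y]))).
      rewrite [leRHS]mulrCA ler_pM2l //; apply: le_trans (Sb y) _.
      by rewrite ler_pM2l // (hdot_S_le_TiS a0 ak Sk Ssym TiK).
    rewrite ler_pM2l // -hdotZl.
    have -> : g *: Ti (S y) = w - (gradient pot (X t) - v0) by rewrite /w addrC addKr.
    rewrite hdotDl hdotNl -hdotNl; apply: lerD; first exact: hdot_le.
    apply: le_trans (hdot_le _ _) _; rewrite normrN ler_wpM2r //.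
    exact: gradLP.
  have -> : b ^+ 2 * (`|w| * `|y| + L * `|y| * `|y|) =
    (b ^+ 2 * `|w| + L * b ^+ 2 * `|y|) * `|y| by ring.
  rewrite expr2 mulrA ler_pM2r // => h.
  rewrite -(ltr_pM2l gap).
  apply: (@le_lt_trans _ _ (b ^+ 2 * `|w|)); first by lra.
  rewrite -ltr_pdivlMl //; apply: lt_le_trans wlt _.
  by rewrite [leRHS]mulrA (mulrC _^-1).
have -> : X = (fun t => X t - Xhat + Xhat) by apply/funext => t; rewrite subrK.
rewrite -[X in _ --> X]add0r; apply: cvgD => //; exact: cvg_cst.
Qed.

End ClosedLoop.

(* Upper bounds of the form 1 / a are compared in \bar R, where 0^-1 = +oo, so
   that they impose nothing when BBadj B = 0. *)
Theorem theorem5p12 (R : realType) (E U : hilbertType R) (B : {linear U -> E})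
  (Bcont : continuous B) (Bclosed : closed (range B)) :
  (forall (pot : E -> R) (potlow : R) (Psi : E -> {linear E -> E}) (Xhat : E),
     potential pot potlow -> damping Psi ->
     unif_continuous (gradient pot) ->
     (exists (psi : R) (E0 : set E),
        [/\ 0 < psi, closed_subspace E0, E0 `<=` range B &
            forall x v : E,
              psi * `|v - orthoproj E0 v| ^+ 2 <= '[v, Psi x v]]) ->
     forall dt rho c : R,
     0 < dt -> 0 <= c -> 0 < rho ->
     (rho%:E
        < ((dt ^+ 3 * (1 + c * dt ^+ 2) * opnorm (BBadj B))%:E)^-1)%E ->
     forall X V : R -> E,
     solution B Psi (gradient pot) Xhat rho dt c X V ->
     V t @[t --> +oo] --> (0 : E) /\
     gradient pot (X t)
       + c3 rho dt c *:
           (pinv [set: E] (opT B rho dt c)) (BBadj B (X t - Xhat))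
       @[t --> +oo] --> (0 : E))
  /\
  (range B = [set: E] ->
   forall L : R, 0 <= L ->
   exists2 K : R, 0 < K &
     forall (pot : E -> R) (potlow : R) (Psi : E -> {linear E -> E}) (Xhat : E),
     potential pot potlow -> damping Psi ->
     L.-lipschitz (gradient pot) ->
     forall dt rho c : R,
     0 < dt -> (dt%:E < ((Num.sqrt (K * opnorm (BBadj B)))%:E)^-1)%E ->
     K * opnorm (BBadj B) / (1 - dt ^+ 2 * K * opnorm (BBadj B)) < c ->
     K / (c * dt ^+ 3) < rho ->
     (rho%:E
        < ((dt ^+ 3 * (1 + c * dt ^+ 2) * opnorm (BBadj B))%:E)^-1)%E ->
     forall X V : R -> E,
     solution B Psi (fun x => gradient pot x - gradient pot Xhat) Xhat
       rho dt c X V ->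
     V t @[t --> +oo] --> (0 : E) /\ X t @[t --> +oo] --> Xhat).
Proof.
have bound_ge0 (dt c : R) : 0 < dt -> 0 <= c ->
    0 <= dt ^+ 3 * (1 + c * dt ^+ 2) * opnorm (BBadj B).
  move=> dt0 c0; have [S SE] := linear_bundle (BBadj_linear Bcont).
  have [k _ kP] := BBadj_bounded Bcont; rewrite SE in kP *.
  rewrite mulr_ge0 ?(opnorm_ge0 (bounded_continuous kP)) // mulr_ge0 //.
    by rewrite exprn_ge0 // ltW.
  by rewrite addr_ge0 // mulr_ge0 // sqr_ge0.
have c2_lt1 (dt c rho : R) : 0 < dt -> 0 <= c ->
    (rho%:E < ((dt ^+ 3 * (1 + c * dt ^+ 2) * opnorm (BBadj B))%:E)^-1)%E ->
    c2 rho dt c * opnorm (BBadj B) < 1.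
  move=> dt0 c0 /(mulr_lt1_of_lt_inve (bound_ge0 _ _ dt0 c0)).
  by rewrite /c2 !mulrA.
split=> [pot potlow Psi Xhat potP Psi_damp gradU [psi [E0 [psi0 E0cl E0B psiP]]]
    dt rho c dt0 c0 rho0 rho_lt X V sol|Bsurj L L0].
  exact: (closed_loop_partial_damping Bcont Bclosed potP Psi_damp gradU psi0
    E0cl E0B psiP dt0 c0 rho0 (c2_lt1 _ _ _ dt0 c0 rho_lt) sol).
have [b b0 bP] := adjoint_bounded_below Bcont Bclosed.
have K0 : 0 < L * b ^+ 2 + 1 by rewrite ltr_wpDl // mulr_ge0 // sqr_ge0.
(* The [+ 1] makes [K] positive even for [L = 0]; the lower bound on [rho] then says
   [K < c3 rho dt c]. *)
exists (L * b ^+ 2 + 1) => //.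
set K := L * b ^+ 2 + 1 in K0 *.
move=> pot potlow Psi Xhat potP Psi_damp gradL dt rho c dt0 dt_lt c_gt rho_gt
  rho_lt X V sol.
have kap0 : 0 <= K * opnorm (BBadj B).
  have := bound_ge0 1 0 ltr01 (lexx 0); rewrite expr1n mul0r addr0 !mul1r.
  by move=> ?; rewrite mulr_ge0 // ltW.
(* Makes the denominator in the lower bound on [c] positive, whence [c > 0]. *)
have dt2 : dt ^+ 2 * K * opnorm (BBadj B) < 1.
  have lt1 := mulr_lt1_of_lt_inve (sqrtr_ge0 _) dt_lt.
  rewrite -mulrA -(sqr_sqrtr kap0) -exprMn.
  by rewrite expr_lt1 // mulr_ge0 ?sqrtr_ge0 // ltW.
have c0 : 0 < c by apply: le_lt_trans c_gt; rewrite divr_ge0 // subr_ge0 ltW.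
have cdt0 : 0 < c * dt ^+ 3 by rewrite mulr_gt0 // exprn_gt0.
have rho0 : 0 < rho by apply: lt_trans rho_gt; rewrite divr_gt0.
apply: (closed_loop_surjective Bcont L0 b0 _ potP Psi_damp gradL dt0 (ltW c0)
  rho0 _ (c2_lt1 _ _ _ dt0 (ltW c0) rho_lt) sol).
  by move=> y; apply: bP; rewrite Bsurj.
move: rho_gt; rewrite ltr_pdivrMr // /c3 /K.
have -> : rho * (c * dt ^+ 3) = c * rho * dt ^+ 3 by ring.
by apply: lt_trans; rewrite ltrDl.
Qed.
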